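(* Let $k$ be a non-Archimedean local field with ring of integers $\mathcal{O}$. Let $A$ be a countable infinite subgroup of the group of units $\mathcal{O}^*$. Let $\widehat{\mathcal{O}}$ be the (discrete) Pontryagin dual of the compact additive group of $\mathcal{O}$, with $A$ acting on $\widehat{\mathcal{O}}$ by the action dual to multiplication on $\mathcal{O}$. Then the discrete group $G=A\ltimes\widehat{\mathcal{O}}$ is not Hilbert--Schmidt stable.
   Context: Hilbert--Schmidt stability: for $A,B\in \mathrm{U}(n)$ (the unitary group of degree $n$) put $d_{\mathrm{HS}}(A,B)=\sqrt{\tfrac1n \mathrm{tr}((A-B)^*(A-B))}$. An asymptotic homomorphism of a discrete group $G$ is a sequence of maps $f_n:G\to \mathrm{U}(n)$, $n\in\mathbb{N}$, with $d_{\mathrm{HS}}(f_n(g)f_n(h),f_n(gh))\to 0$ as $n\to\infty$ for all $g,h\in G$. The group $G$ is Hilbert--Schmidt stable if for any asymptotic homomorphism $(f_n)$ there are group homomorphisms $\varphi_n:G\to \mathrm{U}(n)$ with $d_{\mathrm{HS}}(f_n(g),\varphi_n(g))\to0$ for all $g\in G$. *)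

(* Defs.v *)
From HB Require Import structures.
From mathcomp Require Import all_boot all_order all_algebra spectral.
From mathcomp Require Import complex.
From mathcomp Require Import all_classical reals topology tvs normedtype.

Set Implicit Arguments.
Unset Strict Implicit.
Unset Printing Implicit Defensive.

Import Order.TTheory GRing.Theory Num.Theory.
Import numFieldNormedType.Exports.

Local Open Scope classical_set_scope.
Local Open Scope ring_scope.
Local Open Scope complex_scope.
Local Open Scope sesquilinear_scope.

Section Subgroup.
Variables (G : groupType) (A : groupClosed G).

Definition subgroup := {x : G | x \in A}.

Fact subgroup_closed : group_closed (fun x : G => x \in A).
Proof. by split=> [|x y Ax Ay]; [exact: gpred1|exact: gpredF]. Qed.

HB.instance Definition _ := SubChoice.on subgroup.
HB.instance Definition _ :=
  SubChoice_isSubGroup.Build G (fun x : G => x \in A) subgroup subgroup_closed.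

End Subgroup.

(* A unit is encoded as the pair of the unit and its inverse; the two-sided
   condition reduces to one equation because S is commutative. *)
Section UnitGroup.
Variable S : comNzRingType.

Definition unit_group := {p : S * S | p.1 * p.2 == 1}.

HB.instance Definition _ := SubChoice.on unit_group.

Definition unit_val (u : unit_group) : S := (val u).1.

Let one_subproof : (1 : S) * 1 == 1. Proof. by rewrite mulr1. Qed.
Let one : unit_group := exist _ (1, 1) one_subproof.

Let mul_subproof (u v : unit_group) :
  ((val u).1 * (val v).1) * ((val u).2 * (val v).2) == 1.
Proof. by rewrite mulrACA (eqP (valP u)) (eqP (valP v)) mulr1. Qed.
Let mul (u v : unit_group) : unit_group :=
  exist _ ((val u).1 * (val v).1, (val u).2 * (val v).2) (mul_subproof u v).

Let inv_subproof (u : unit_group) : (val u).2 * (val u).1 == 1.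
Proof. by rewrite mulrC (valP u). Qed.
Let inv (u : unit_group) : unit_group :=
  exist _ ((val u).2, (val u).1) (inv_subproof u).

Let mulgA : associative mul.
Proof. by move=> u v w; apply: val_inj; rewrite /= !mulrA. Qed.
Let mul1g : left_id one mul.
Proof. by move=> u; apply: val_inj; rewrite /= !mul1r; case: (val u). Qed.
Let mulg1 : right_id one mul.
Proof. by move=> u; apply: val_inj; rewrite /= !mulr1; case: (val u). Qed.
Let mulVg : left_inverse one inv mul.
Proof.
move=> u; apply: val_inj => /=.
by rewrite (eqP (valP u)) (eqP (inv_subproof u)).
Qed.
Let mulgV : right_inverse one inv mul.
Proof.
move=> u; apply: val_inj => /=.
by rewrite (eqP (valP u)) (eqP (inv_subproof u)).
Qed.

HB.instance Definition _ :=
  isGroup.Build unit_group mulgA mul1g mulg1 mulVg mulgV.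

Lemma unit_valM (u v : unit_group) :
  unit_val (u * v)%g = unit_val u * unit_val v.
Proof. by []. Qed.

Lemma unit_val1 : unit_val 1%g = 1. Proof. by []. Qed.

End UnitGroup.

Record auto_action (A N : groupType) := AutoAction {
  act :> A -> N -> N;
  act1 : forall x, act 1%g x = x;
  actM : forall a b x, act (a * b)%g x = act a (act b x);
  act_morph : forall a, {morph act a : x y / (x * y)%g} }.

Definition restrict_action (A N : groupType) (B : groupClosed A)
    (to : auto_action A N) : auto_action (subgroup B) N :=
  @AutoAction (subgroup B) N (fun b => to (val b)) (act1 to)
    (fun a b => actM to (val a) (val b)) (fun a => act_morph to (val a)).

Section SemidirectProduct.
Variables (A N : groupType) (to : auto_action A N).

(* (a, x) stands for the product x a, so that a x a^-1 = to a x. *)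
Definition semidirect : Type := let _ := to in (A * N)%type.

HB.instance Definition _ := Choice.on semidirect.

Let one : semidirect := (1%g, 1%g).
Let mul (g h : semidirect) : semidirect :=
  (g.1 * h.1, g.2 * to g.1 h.2)%g.
Let inv (g : semidirect) : semidirect := (g.1^-1, to g.1^-1 g.2^-1)%g.

Let to1 a : to a 1%g = 1%g.
Proof. by apply: (@mulIg N (to a 1%g)); rewrite mul1g -act_morph mulg1. Qed.

Let mulgA : associative mul.
Proof. by move=> g h l; rewrite /mul /= act_morph actM !mulgA. Qed.
Let mul1g : left_id one mul.
Proof. by case=> a x; rewrite /mul /= act1 !mul1g. Qed.
Let mulg1 : right_id one mul.
Proof. by case=> a x; rewrite /mul /= to1 !mulg1. Qed.
Let mulVg : left_inverse one inv mul.
Proof. by move=> g; rewrite /mul /= -act_morph !mulVg to1. Qed.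
Let mulgV : right_inverse one inv mul.
Proof. by move=> g; rewrite /mul /= -actM !mulgV act1 mulgV. Qed.

HB.instance Definition _ :=
  isGroup.Build semidirect mulgA mul1g mulg1 mulVg mulgV.

End SemidirectProduct.

Section UnitaryGroup.
Variables (R : realType) (n : nat).

Definition unitary_group := {M : 'M[R[i]]_n | M \is unitarymx}.

HB.instance Definition _ := SubChoice.on unitary_group.

Let adjE (M : 'M[R[i]]_n) : M \is unitarymx -> M^t* *m M = 1%:M.
Proof. by move=> /unitarymxP/mulmx1C. Qed.

Let one_subproof : (1%:M : 'M[R[i]]_n) \is unitarymx.
Proof. by apply/unitarymxP; rewrite trmx1 map_mx1 mulmx1. Qed.
Let one : unitary_group := exist _ 1%:M one_subproof.
Let mul (u v : unitary_group) : unitary_group :=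
  exist _ (val u *m val v) (mul_unitarymx (valP u) (valP v)).
Let inv_subproof (u : unitary_group) : (val u)^t* \is unitarymx.
Proof. by rewrite trmxC_unitary (valP u). Qed.
Let inv (u : unitary_group) : unitary_group :=
  exist _ ((val u)^t*) (inv_subproof u).

Let mulgA : associative mul.
Proof. by move=> u v w; apply: val_inj; rewrite /= mulmxA. Qed.
Let mul1g : left_id one mul.
Proof. by move=> u; apply: val_inj; rewrite /= mul1mx. Qed.
Let mulg1 : right_id one mul.
Proof. by move=> u; apply: val_inj; rewrite /= mulmx1. Qed.
Let mulVg : left_inverse one inv mul.
Proof. by move=> u; apply: val_inj; rewrite /= (adjE (valP u)). Qed.
Let mulgV : right_inverse one inv mul.
Proof. by move=> u; apply: val_inj; rewrite /= (unitarymxP (valP u)). Qed.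

HB.instance Definition _ :=
  isGroup.Build unitary_group mulgA mul1g mulg1 mulVg mulgV.

(* The trace is a nonnegative real; Re only moves it from R[i] to R. *)
Definition hs_dist (u v : unitary_group) : R :=
  let D := val u - val v in
  Num.sqrt (n%:R^-1 * complex.Re (\tr (D^t* *m D))).

End UnitaryGroup.

(* The index n = 0, where the unitary group is trivial, is harmless since
   only limits for n going to infinity are involved. *)
Definition asymptotic_hom (R : realType) (G : groupType)
    (f : forall n, G -> unitary_group R n) :=
  forall g h, (fun n => hs_dist (f n g * f n h)%g (f n (g * h)%g)) @ \oo
    --> (0 : R).

Definition hs_stable (R : realType) (G : groupType) :=
  forall f : (forall n, G -> unitary_group R n), asymptotic_hom f ->
  exists phi : (forall n, {multiplicative G -> unitary_group R n}),
    forall g, (fun n => hs_dist (f n g) (phi n g)) @ \oo --> (0 : R).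

(* R[i]^o is R[i] with the topology given by its modulus. *)
Record is_character (R : realType) (T : topologicalZmodType)
    (chi : T -> R[i]) : Prop := IsCharacter {
  character_continuous : continuous (chi : T -> R[i]^o);
  characterD : {morph chi : x y / x + y >-> x * y};
  character_norm : forall x, `|chi x| = 1 }.

Section PontryaginDual.
Variables (R : realType) (T : topologicalZmodType).

Definition pontryagin_dual := {chi : T -> R[i] | `[< is_character chi >]}.

HB.instance Definition _ := SubChoice.on pontryagin_dual.

Definition dual_eval (chi : pontryagin_dual) : T -> R[i] := val chi.
Coercion dual_eval : pontryagin_dual >-> Funclass.

Lemma dualP (chi : pontryagin_dual) : is_character chi.
Proof. exact/asboolP/(valP chi). Qed.

Lemma dual_neq0 (chi : pontryagin_dual) x : chi x != 0.
Proof. by rewrite -normr_eq0 (character_norm (dualP chi)) oner_eq0. Qed.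

Definition Dual (chi : T -> R[i]) (h : is_character chi) : pontryagin_dual :=
  exist _ chi (asboolT h).

Let one_subproof : is_character (fun _ : T => 1 : R[i]).
Proof.
split=> [x|x y|x]; first exact: cvg_cst.
  by rewrite mulr1.
by rewrite normr1.
Qed.
Let one : pontryagin_dual := Dual one_subproof.

Let mul_subproof (chi psi : pontryagin_dual) :
  is_character (fun x => chi x * psi x).
Proof.
split=> [x|x y|x].
- have hchi := character_continuous (dualP chi) (x := x).
  have hpsi := character_continuous (dualP psi) (x := x).
  exact: (@cvgM R[i] _ _ _ _ _ _ _ hchi hpsi).
- by rewrite (characterD (dualP chi)) (characterD (dualP psi)) mulrACA.
- by rewrite normrM !character_norm ?mulr1//; exact: dualP.
Qed.
Let mul chi psi : pontryagin_dual := Dual (mul_subproof chi psi).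

Let inv_subproof (chi : pontryagin_dual) :
  is_character (fun x => (chi x)^-1).
Proof.
split=> [x|x y|x].
- have hchi := character_continuous (dualP chi) (x := x).
  exact: (@cvgV R[i] _ _ _ _ _ (dual_neq0 chi x) hchi).
- by rewrite (characterD (dualP chi)) invfM.
- by rewrite normfV character_norm ?invr1//; exact: dualP.
Qed.
Let inv chi : pontryagin_dual := Dual (inv_subproof chi).

Let mulgA : associative mul.
Proof.
by move=> u v w; apply: val_inj; apply/funext => x; rewrite /= /dual_eval mulrA.
Qed.
Let mul1g : left_id one mul.
Proof.
by move=> u; apply: val_inj; apply/funext => x; rewrite /= /dual_eval mul1r.
Qed.
Let mulg1 : right_id one mul.
Proof.
by move=> u; apply: val_inj; apply/funext => x; rewrite /= /dual_eval mulr1.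
Qed.
Let mulVg : left_inverse one inv mul.
Proof.
move=> u; apply: val_inj; apply/funext => x; rewrite /= mulVf//.
exact: dual_neq0.
Qed.
Let mulgV : right_inverse one inv mul.
Proof.
move=> u; apply: val_inj; apply/funext => x; rewrite /= mulfV//.
exact: dual_neq0.
Qed.

HB.instance Definition _ :=
  isGroup.Build pontryagin_dual mulgA mul1g mulg1 mulVg mulgV.

End PontryaginDual.

(* A locally compact field whose topology is induced by a nontrivial
   ultrametric absolute value, bundled with that absolute value. Hausdorffness
   and continuity of the field operations follow from nbhs_absvE. *)
HB.mixin Record isNonArchLocalField (R : realType) k
    of GRing.Field k & Topological k := {
  absv : k -> R;
  absv_ge0 : forall x, 0 <= absv x;
  absv_eq0 : forall x, (absv x == 0) = (x == 0);
  absvM : {morph absv : x y / x * y};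
  absvD : forall x y, absv (x + y) <= Num.max (absv x) (absv y);
  absv_nontrivial : exists2 x, x != 0 & absv x != 1;
  nbhs_absvE : forall x : k, nbhs x =
    filter_from [set e | 0 < e] (fun e => [set y : k | absv (x - y) < e]);
  local_field_locally_compact : locally_compact [set: k]
}.

#[short(type="nonArchLocalFieldType")]
HB.structure Definition NonArchLocalField (R : realType) :=
  {k of isNonArchLocalField R k & GRing.Field k & Topological k}.

Section RingOfIntegers.
Variables (R : realType) (k : nonArchLocalFieldType R).
Implicit Types x y : k.

Lemma absv0 : absv (0 : k) = 0.
Proof. by apply/eqP; rewrite absv_eq0. Qed.

Lemma absv1 : absv (1 : k) = 1.
Proof.
have h : absv (1 : k) != 0 by rewrite absv_eq0 oner_eq0.
by apply: (mulfI h); rewrite -absvM !mulr1.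
Qed.

Lemma absvN x : absv (- x) = absv x.
Proof.
have h : absv (-1 : k) = 1.
  have : absv (-1 : k) ^+ 2 == 1 by rewrite expr2 -absvM mulrNN mulr1 absv1.
  by rewrite sqrp_eq1 ?absv_ge0// => /eqP.
by rewrite -mulN1r absvM h mul1r.
Qed.

Definition integral : {pred k} := fun x => absv x <= 1.

Fact integral_subring : subring_closed integral.
Proof.
split=> [|x y|x y]; rewrite !unfold_in.
- by rewrite absv1.
- move=> hx hy; apply: (le_trans (absvD _ _)).
  by rewrite absvN ge_max hx.
- by move=> hx hy; rewrite absvM mulr_ile1 ?absv_ge0.
Qed.
HB.instance Definition _ := GRing.isSubringClosed.Build k integral
  integral_subring.

Definition ring_of_integers := {x : k | integral x}.

HB.instance Definition _ := SubChoice.on ring_of_integers.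
HB.instance Definition _ :=
  [SubChoice_isSubComNzRing of ring_of_integers by <:].
HB.instance Definition _ :=
  Topological.copy ring_of_integers
    (initial_topology (val : ring_of_integers -> k)).

Lemma nbhs_absv (x : k) (e : R) :
  0 < e -> nbhs x [set y : k | absv (x - y) < e].
Proof. by move=> e0; rewrite nbhs_absvE; exists e. Qed.

Lemma integers_val_continuous : continuous (val : ring_of_integers -> k).
Proof. exact: initial_continuous. Qed.

Lemma nbhs_integers_absv (x : ring_of_integers) (e : R) :
  0 < e -> nbhs x [set y : ring_of_integers | absv (val x - val y) < e].
Proof.
by move=> e0; exact: (@integers_val_continuous x _ (nbhs_absv (val x) e0)).
Qed.

Fact integers_sub_continuous :
  continuous (fun p : ring_of_integers * ring_of_integers => p.1 - p.2).
Proof.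
apply: (@continuous_comp_initial _ _ k (val : ring_of_integers -> k))
  => -[x y] U /=.
rewrite nbhs_absvE => -[e /= e0 eU].
exists ([set z | absv (val x - val z) < e],
        [set z | absv (val y - val z) < e]).
  by split; exact: nbhs_integers_absv.
move=> [x' y'] [/= hx hy]; apply: eU => /=.
rewrite -[ltLHS]/(absv ((val x - val y) - (val x' - val y')))
  (_ : _ - _ = (val x - val x') - (val y - val y')).
  by apply: le_lt_trans (absvD _ _) _; rewrite absvN gt_max hx.
by rewrite opprD addrACA -opprD.
Qed.
HB.instance Definition _ := PreTopologicalNmodule_isTopologicalZmodule.Build
  ring_of_integers integers_sub_continuous.

Lemma integers_mul_continuous (c : ring_of_integers) :
  continuous (fun x : ring_of_integers => c * x).
Proof.
apply: (@continuous_comp_initial _ _ k (val : ring_of_integers -> k))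
  => x U /=.
rewrite nbhs_absvE => -[e /= e0 eU].
suff : nbhs x [set z : ring_of_integers | absv (val x - val z) < e].
  apply: filterS => z /= hz; apply: eU => /=.
  rewrite -[ltLHS]/(absv (val c * val x - val c * val z)) -mulrBr absvM; apply: le_lt_trans hz.
  by rewrite ler_piMl ?absv_ge0//; exact: (valP c).
exact: nbhs_integers_absv.
Qed.

Let O := ring_of_integers.

Let dual_act_subproof (u : unit_group O) (chi : pontryagin_dual R O) :
  is_character (fun x : O => chi (unit_val u^-1%g * x)).
Proof.
split=> [x|x y|x].
- have hmul : {for x, continuous (fun z : O => unit_val u^-1%g * z)}.
    exact: integers_mul_continuous.
  exact: (continuous_comp hmul (character_continuous (dualP chi) (x := _))).
- by rewrite mulrDr (characterD (dualP chi)).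
- exact: character_norm (dualP chi) _.
Qed.

(* Contragredient of multiplication. As the unit group is commutative,
   chi |-> chi (u * _) is an action as well, and it yields an isomorphic
   semidirect product through u |-> u^-1. *)
Definition dual_act (u : unit_group O) (chi : pontryagin_dual R O) :=
  Dual (dual_act_subproof u chi).

Let dual_act1 chi : dual_act 1%g chi = chi.
Proof.
apply: val_inj; apply/funext => x /=.
by rewrite invg1 unit_val1 mul1r.
Qed.

Let dual_actM u v chi : dual_act (u * v)%g chi = dual_act u (dual_act v chi).
Proof.
apply: val_inj; apply/funext => x; rewrite /= /dual_eval /=.
by rewrite invgM unit_valM mulrA.
Qed.

Let dual_act_morph u : {morph dual_act u : chi psi / (chi * psi)%g}.
Proof. by move=> chi psi; apply: val_inj. Qed.

Definition dual_action : auto_action (unit_group O) (pontryagin_dual R O) :=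
  AutoAction dual_act1 dual_actM dual_act_morph.

End RingOfIntegers.

(* Main.v *)
Require Import Defs.
From mathcomp Require Import all_boot all_order all_algebra perm.
From mathcomp Require Import spectral mxred complex finmap ring lra.
From mathcomp Require Import all_classical reals topology tvs normedtype.
From mathcomp Require Import sequences.

(** Why the theorem holds.  Write O for the ring of integers.

    A finite-dimensional unitary representation of the semidirect product
    kills the dual of O [finite_dim_rep_trivial].  Its restriction to the
    (commutative) dual is diagonal in some basis, with finitely many diagonal
    homomorphisms l_1, ..., l_n to the circle, and conjugation by a in A
    permutes them: each l_i o a is some l_j.  As A is infinite, l_i o a and
    l_i o b coincide for some a <> b, so l_i is 1 on every character of the
    form (a chi) (b chi)^-1, that is, on x |-> chi (c x) with
    c = a^-1 - b^-1 <> 0.  Every character of O has this form, because a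
    character of the open subgroup c O extends to O [dual_scale_surj]; hence
    l_i = 1.

    On the other hand the group has many approximate representations that do
    not kill the dual.  For a ball I of O, an ideal of finite index, let A act
    on the finite ring O / I by multiplication, and let chi act on functions
    on O / I as multiplication by chi, evaluated at chosen representatives
    [net_rep].  The product rule holds exactly whenever the characters
    involved are trivial on I, and a character of O, having an image without
    small subgroups, is trivial on all sufficiently small balls
    [dual_trivial_near0].  So these maps, for I shrinking to 0, form an
    asymptotic homomorphism.  If chi is trivial on I but not on O, then the
    sum of its values on O / I vanishes, the unitary matrix of chi has trace
    0, and its distance to 1 is sqrt 2 whatever the dimension
    [net_rep_traceless, hs_dist1_traceless].  A nontrivial character exists
    [dual_nontrivial], so no sequence of representations comes close to this
    asymptotic homomorphism.

    The index of I takes only some values; the trivial map is used in the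
    other dimensions. *)

Set Implicit Arguments.
Unset Strict Implicit.
Unset Printing Implicit Defensive.

Import Order.TTheory GRing.Theory Num.Theory.
Import numFieldNormedType.Exports.

Local Open Scope classical_set_scope.
Local Open Scope ring_scope.
Local Open Scope complex_scope.
Local Open Scope sesquilinear_scope.

(** * Extension of characters of abelian groups *)

Section CharacterExtension.
Variables (T : zmodType) (C : closedFieldType).
Implicit Types (H : set T) (chi : T -> C) (x y h : T).

(** The function chi is total, but only its values on the subgroup H matter;
    this avoids subtypes when the domain grows. *)
Record hom_on H chi : Prop := HomOn {
  dom0 : H 0;
  domB : forall x y, H x -> H y -> H (x - y);
  hom_on0 : chi 0 = 1;
  hom_onD : forall x y, H x -> H y -> chi (x + y) = chi x * chi y }.

Lemma domD H chi x y : hom_on H chi -> H x -> H y -> H (x + y).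
Proof.
move=> hH hx hy; rewrite -[y]opprK; apply: (domB hH) => //.
by rewrite -sub0r; apply: (domB hH) => //; exact: dom0 hH.
Qed.

Lemma domMn H chi x n : hom_on H chi -> H x -> H (x *+ n).
Proof.
move=> hH hx; elim: n => [|n IH]; first by rewrite mulr0n; exact: dom0 hH.
by rewrite mulrS; apply: (domD hH).
Qed.

Lemma hom_onMn H chi x n : hom_on H chi -> H x -> chi (x *+ n) = chi x ^+ n.
Proof.
move=> hH hx; elim: n => [|n IH]; first by rewrite mulr0n expr0 (hom_on0 hH).
by rewrite mulrS exprS -IH (hom_onD hH)//; apply: domMn hH hx.
Qed.

Lemma order_mod H chi x :
  hom_on H chi -> (exists2 n, (0 < n)%N & H (x *+ n)) ->
  exists2 m, (0 < m)%N & forall n, H (x *+ n) <-> (m %| n)%N.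
Proof.
move=> hH [n0 n0_gt0 Hn0].
have ex : exists n, (0 < n)%N && `[< H (x *+ n) >].
  by exists n0; rewrite n0_gt0; apply/asboolP.
case: (ex_minnP ex) => m /andP[m_gt0 /asboolP Hm] m_min.
exists m => // n; split=> [Hn|/dvdnP[q ->]]; last first.
  by rewrite mulnC mulrnA; apply: domMn hH Hm.
rewrite /dvdn -leqn0 leqNgt; apply/negP => r_gt0.
have /m_min : (0 < n %% m)%N && `[< H (x *+ (n %% m)) >].
  rewrite r_gt0; apply/asboolP.
  have -> : x *+ (n %% m) = x *+ n - x *+ m *+ (n %/ m).
    by rewrite {2}(divn_eq n m) mulrnDr mulnC mulrnA addrC addKr.
  by apply: (domB hH) => //; apply: domMn hH Hm.
by rewrite leqNgt ltn_pmod.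
Qed.

(** The group H' is H + Z x.  Its elements h + j x determine j only modulo m,
    and w ^+ m = chi (x *+ m) is exactly what makes chi h * w ^+ j independent
    of the choice of (h, j).  Leaving w free is what allows a nontrivial
    extension of the trivial character. *)
Lemma extend_one H chi x m w : hom_on H chi -> (0 < m)%N ->
    (forall n, H (x *+ n) <-> (m %| n)%N) -> w ^+ m = chi (x *+ m) ->
  exists H' chi', [/\ hom_on H' chi', H `<=` H', H' x,
    (forall y, H y -> chi' y = chi y) & chi' x = w].
Proof.
move=> hH m_gt0 xH wm.
pose dec y : set (T * nat) := [set p | H p.1 /\ y = p.1 + x *+ p.2].
pose H' y := exists p, dec y p.
pose chi' y := let p := xget (0, 0%N) (dec y) in chi p.1 * w ^+ p.2.
have powE q : w ^+ (m * q) = chi (x *+ (m * q)).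
  by rewrite exprM wm mulrnA [RHS](hom_onMn _ hH)//; apply: (xH m).2.
have uniq h j h' j' : H h -> H h' -> (j <= j')%N ->
    h + x *+ j = h' + x *+ j' -> chi h * w ^+ j = chi h' * w ^+ j'.
  move=> Hh Hh' jj' E.
  have hE : h = h' + x *+ (j' - j).
    by rewrite mulrnBr// addrA -E addrK.
  have Hd : H (x *+ (j' - j)).
    have -> : x *+ (j' - j) = h - h' by rewrite hE addrC addKr.
    exact: (domB hH).
  have /dvdnP[q qE] := (xH _).1 Hd.
  rewrite hE (hom_onD hH)// -{2}(subnK jj') exprD mulrA.
  by rewrite {1 2}qE mulnC -powE.
have chi'E h j : H h -> chi' (h + x *+ j) = chi h * w ^+ j.
  move=> Hh; rewrite /chi'; set p := xget _ _.
  have [Hp pE] : dec (h + x *+ j) p.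
    by apply: xgetPex; exists (h, j).
  have [le|/ltnW le] := leqP p.2 j.
    by apply: uniq.
  by apply/esym/uniq.
have Hsub : H `<=` H' by move=> h Hh; exists (h, 0%N); rewrite /dec/= addr0.
have agree y : H y -> chi' y = chi y.
  by move=> Hy; have := chi'E _ 0%N Hy; rewrite mulr0n addr0 expr0 mulr1.
exists H', chi'; split=> //.
- split.
  + exact/Hsub/(dom0 hH).
  + move=> _ _ [[h j] [/= Hh ->]] [[h' j'] [/= Hh' ->]].
    (* the multiple m j' - j' of x replaces - j' x up to an element of H *)
    exists (h - h' - x *+ (m * j'), (j + (m * j' - j'))%N); split => /=.
      apply: (domB hH); first exact: (domB hH).
      by rewrite mulrnA; apply: domMn hH _; apply: (xH _).2.
    rewrite mulrnDr mulrnBr ?leq_pmull//.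
    by rewrite opprD addrACA [RHS]addrCA subrKA [RHS]addrCA.
  + by rewrite agree ?(hom_on0 hH)//; exact: dom0 hH.
  + move=> _ _ [[h j] [/= Hh ->]] [[h' j'] [/= Hh' ->]].
    rewrite addrACA -mulrnDr !chi'E//; last exact: domD hH _ _.
    by rewrite (hom_onD hH)// exprD mulrACA.
- by exists (0, 1%N); split => /=; [exact: dom0 hH|rewrite add0r].
- have := chi'E 0 1%N (dom0 hH).
  by rewrite add0r mulr1n (hom_on0 hH) mul1r expr1.
Qed.

Lemma closed_field_root (a : C) m : (0 < m)%N -> exists w, w ^+ m = a.
Proof.
move=> m_gt0; have [w] :=
  solve_monicpoly (fun i => if i == 0%N then a else 0) m_gt0.
move=> wE; exists w; rewrite wE; case: m m_gt0 {wE} => // m _.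
rewrite big_ord_recl /= expr0 mulr1 big1 ?addr0// => i _.
by rewrite mul0r.
Qed.

Lemma extend_seq (s : seq T) H chi : hom_on H chi ->
    (forall x, exists2 n, (0 < n)%N & H (x *+ n)) ->
  exists H' chi', [/\ hom_on H' chi', H `<=` H', {in s, forall x, H' x} &
    forall y, H y -> chi' y = chi y].
Proof.
elim: s H chi => [|x s IH] H chi hH tors.
  by exists H, chi; split=> // x; rewrite in_nil.
have [m m_gt0 xH] := order_mod hH (tors x).
have [w wE] := closed_field_root (chi (x *+ m)) m_gt0.
have [H1 [chi1 [h1 HH1 H1x e1 _]]] := extend_one hH m_gt0 xH wE.
have [|H2 [chi2 [h2 H12 H2s e2]]] := IH _ _ h1.
  by move=> y; have [n n_gt0 Hn] := tors y; exists n => //; apply: HH1.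
exists H2, chi2; split=> //.
- exact: subset_trans H12.
- by move=> y; rewrite inE => /orP[/eqP->|/H2s//]; apply: H12.
- by move=> y Hy; rewrite e2 ?e1//; apply: HH1.
Qed.

(** With a finite list of coset representatives of H, the whole group is
    reached by adjoining them one at a time. *)
Lemma extend_hom (s : seq T) H chi : hom_on H chi ->
    (forall x, exists2 n, (0 < n)%N & H (x *+ n)) ->
    (forall y, exists2 x, x \in s & H (y - x)) ->
  exists2 chi', {morph chi' : x y / x + y >-> x * y} &
    forall y, H y -> chi' y = chi y.
Proof.
move=> hH tors cov.
have [H' [chi' [h' HH' H's e]]] := extend_seq s hH tors.
have total y : H' y.
  have [x /H's Hx /HH' Hyx] := cov y.
  by rewrite -(subrK x y); apply: domD h' _ _.
by exists chi' => // x y; apply: (hom_onD h').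
Qed.

(** A root of 1 + X + ... + X^(m-1), which is not constant and does not vanish
    at 1. *)
Lemma unity_root_neq1 m : (1 < m)%N -> m%:R != 0 :> C ->
  exists2 w : C, w ^+ m = 1 & w != 1.
Proof.
move=> m_gt1 m_neq0.
pose p : {poly C} := \poly_(i < m) 1.
have sp : size p = m by rewrite size_poly_eq ?oner_eq0.
have [w wp] : exists w, root p w.
  by apply/closed_rootP; rewrite sp; apply: contraL m_gt1 => /eqP->.
exists w.
  apply/eqP; rewrite -subr_eq0 subrX1.
  suff -> : \sum_(i < m) w ^+ i = p.[w] by rewrite (rootP wp) mulr0.
  by rewrite horner_poly; apply: eq_bigr => i _; rewrite mul1r.
apply: contraNneq m_neq0 => w1; move: wp.
rewrite w1 /root horner_poly.
under eq_bigr do rewrite expr1n mulr1.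
by rewrite sumr_const card_ord.
Qed.

End CharacterExtension.

(** * Balls and finite nets in a local field *)

Lemma expr_eventually_lt (R : realType) (q : R) (e : R) : 0 <= q < 1 -> 0 < e ->
  exists M, forall m, (M <= m)%N -> q ^+ m < e.
Proof.
move=> /andP[q0 q1] e0.
have /cvgrPdist_lt /(_ e e0) [M _ hM] : (fun n => q ^+ n) @ \oo --> 0.
  by apply: cvg_expr; rewrite ger0_norm.
exists M => m /hM; rewrite /= sub0r normrN ger0_norm//.
exact: exprn_ge0.
Qed.

Section LocalField.
Variables (R : realType) (k : nonArchLocalFieldType R).
Implicit Types (x y z : k) (e : R).

Lemma absvB x y : absv (x - y) = absv (y - x).
Proof. by rewrite -absvN opprB. Qed.

Lemma absvXn x n : absv (x ^+ n) = absv x ^+ n.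
Proof.
elim: n => [|n IH]; first by rewrite !expr0 absv1.
by rewrite !exprS absvM IH.
Qed.

Lemma absv_gt0 x : (0 < absv x) = (x != 0).
Proof. by rewrite lt_neqAle absv_ge0 andbT eq_sym absv_eq0. Qed.

Lemma absvV x : absv x^-1 = (absv x)^-1.
Proof.
have [->|x0] := eqVneq x 0; first by rewrite invr0 absv0 invr0.
have h : absv x != 0 by rewrite absv_eq0.
by apply: (mulfI h); rewrite -absvM !divff// absv1.
Qed.

Lemma absvD_lt e x y : absv x < e -> absv y < e -> absv (x + y) < e.
Proof.
by move=> hx hy; apply: le_lt_trans (absvD _ _) _; rewrite gt_max hx.
Qed.

Lemma ball_trans y x z e :
  absv (x - y) < e -> absv (y - z) < e -> absv (x - z) < e.
Proof. by move=> hxy hyz; rewrite -(subrKA y); exact: absvD_lt. Qed.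

Lemma absv_lt1 : exists x, 0 < absv x < 1.
Proof.
have [x x0 x1] := @absv_nontrivial R k.
have [lt|gt|/eqP eq] := ltgtP (absv x) 1; last by rewrite (negbTE x1) in eq.
  by exists x; rewrite lt absv_gt0 x0.
exists x^-1; rewrite absv_gt0 invr_eq0 x0 absvV.
by rewrite invf_lt1// absv_gt0.
Qed.

Lemma absv_small e : 0 < e -> exists x, 0 < absv x < e.
Proof.
move=> e0; have [p /andP[p0 p1]] := absv_lt1.
have [|M /(_ _ (leqnn _)) pM] := @expr_eventually_lt _ (absv p) e _ e0.
  by rewrite p1 ltW.
by exists (p ^+ M); rewrite absvXn pM exprn_gt0.
Qed.

(** A compact neighbourhood of 0 contains a ball; compactness is used in its
    filter form, along the filter of finite lists ordered by inclusion. *)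
Lemma totally_bounded_ball : exists2 r, 0 < r & forall e, 0 < e ->
  exists s : seq k, forall x, absv x < r ->
    exists2 y, y \in s & absv (x - y) < e.
Proof.
have [K] := @local_field_locally_compact R k 0 I.
rewrite /within /= nbhs_absvE => -[r /= r0 rK] [/compact_near_coveringP cK _].
exists r => // e e0.
pose F : set_system (seq k) :=
  filter_from setT (fun s0 : seq k => [set s : seq k | {subset s0 <= s}]).
have FF : Filter F.
  apply: filter_from_filter; first by exists [::].
  move=> s1 s2 _ _; exists (s1 ++ s2) => // s /= h.
  by split=> x hx; apply: h; rewrite mem_cat hx ?orbT.
pose covers (s : seq k) x := exists2 y, y \in s & absv (x - y) < e.
have [|s0 _ /(_ s0)] := cK _ F covers FF.
  move=> x _.
  exists ([set y : k | absv (x - y) < e], [set s : seq k | x \in s]).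
    split; first exact: nbhs_absv.
    by exists [:: x] => // s /= h; apply: h; rewrite inE.
  by move=> [x' s] /= [hx hs]; exists x => //; rewrite absvB.
move=> h; exists s0 => x hx; apply: (h (fun x h => h)).
by apply: rK => //=; rewrite sub0r absvN.
Qed.

End LocalField.

Section Integers.
Variables (R : realType) (k : nonArchLocalFieldType R).
Notation O := (ring_of_integers k).
Implicit Types (x y : O) (e : R).

Lemma valO_B x y : val (x - y) = val x - val y. Proof. by []. Qed.

(** Scaling by a small nonzero c moves the whole ring of integers into the
    precompact ball around 0.  The scale e may be assumed at most 1, so that a
    point of k within e of an integer is an integer. *)
Lemma totally_bounded_integers e : 0 < e ->
  exists s : seq O, forall x, exists2 y, y \in s & absv (val x - val y) < e.
Proof.
wlog e1 : e / e <= 1 => [hw e0|e0].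
  have [||s hs] := hw (Num.min e 1).
  - by rewrite ge_min lexx orbT.
  - by rewrite lt_min e0 ltr01.
  exists s => x; have [y ys xy] := hs x; exists y => //.
  by apply: lt_le_trans xy _; rewrite ge_min lexx.
have [r r0 hr] := @totally_bounded_ball R k.
have [c /andP[c0 cr]] := @absv_small R k r r0.
have c_neq0 : c != 0 by rewrite -absv_gt0.
have [s hs] := hr (e * absv c) (mulr_gt0 e0 c0).
exists [seq insubd (0 : O) (z / c) | z : k <- s] => x.
have [|y ys xy] := hs (c * val x).
  rewrite absvM; apply: le_lt_trans cr.
  by rewrite ler_piMr ?absv_ge0//; exact: (valP x).
have xyc : absv (val x - y / c) < e.
  rewrite -(ltr_pM2r c0) -absvM mulrBl divfK//.
  by rewrite (mulrC (val x)).
exists (insubd (0 : O) (y / c)); first exact: map_f.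
rewrite insubdK// /in_mem/= /integral -[y / c](subKr (val x)).
apply: le_trans (absvD _ _) _; rewrite absvN ge_max.
by rewrite [_ <= 1](valP x) (le_trans (ltW xyc)).
Qed.

(** An e-net is a numbering, with representatives, of the finite quotient of
    the ring of integers by the ball of radius e. *)
Record net e := Net {
  net_size : nat;
  net_pt : 'I_net_size -> O;
  net_idx : O -> 'I_net_size;
  net_ptK : cancel net_pt net_idx;
  net_idxE : forall x y,
    (net_idx x == net_idx y) = (absv (val x - val y) < e) }.

Arguments net_pt {e} n.
Arguments net_idx {e} n.

(** The first point of the covering list within e of x depends only on the
    ball around x, by the ultrametric inequality, hence is a canonical
    representative. *)
Lemma net_exists e : 0 < e -> exists _ : net e, True.
Proof.
move=> e0; have [s hs] := totally_bounded_integers e0.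
pose near x y := absv (val x - val y) < e.
pose rep x := nth 0 s (find (near x) s).
have hasP x : has (near x) s by apply/hasP; have [y] := hs x; exists y.
have rep_near x : near x (rep x) by apply: nth_find.
have rep_in x : rep x \in s by rewrite mem_nth// -has_find.
have repP x y : (rep x == rep y) = near x y.
  apply/eqP/idP => [E|xy].
    apply: (@ball_trans _ _ (val (rep x))) (rep_near x) _.
    by rewrite E absvB; exact: rep_near.
  rewrite /rep; congr (nth 0 s _); apply: eq_find => z.
  apply/idP/idP; apply: ball_trans => //.
  by rewrite absvB.
have repK x : rep (rep x) = rep x.
  by apply/eqP; rewrite repP /near absvB; exact: rep_near.
pose s' := undup (map rep s).
have s'P x : rep x \in s' by rewrite mem_undup -repK map_f.
have idxP x : (index (rep x) s' < size s')%N by rewrite index_mem.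
have fix_s' z : z \in s' -> rep z = z.
  by rewrite mem_undup => /mapP[y _ ->]; exact: repK.
pose idx x := Ordinal (idxP x).
unshelve eexists (@Net e (size s') (fun i => nth 0 s' i) idx _ _) => //.
- move=> i; apply: val_inj => /=.
  by rewrite fix_s' ?mem_nth// index_uniq// undup_uniq.
- move=> x y; rewrite -val_eqE /= -[RHS]/(near x y) -repP.
  apply/eqP/eqP => [|->//].
  by move=> /(congr1 (nth 0 s')); rewrite !nth_index.
Qed.

Lemma net_near e (N : net e) x y :
  net_idx N x = net_idx N y <-> absv (val x - val y) < e.
Proof. by rewrite -(net_idxE N); split=> /eqP. Qed.

Lemma net_pt_near e (N : net e) x :
  absv (val x - val (net_pt N (net_idx N x))) < e.
Proof. by apply/(net_near N); rewrite net_ptK. Qed.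

(** The powers p^0, ..., p^m lie in distinct classes: for i < j the distance
    from p^i to p^j is |p|^i |1 - p^(j - i)| = |p|^i >= e. *)
Lemma net_size_gt e (N : net e) (p : O) m :
  0 < absv (val p) < 1 -> e <= absv (val p) ^+ m -> (m < net_size N)%N.
Proof.
move=> /andP[p0 p1] em.
suff /leq_card : injective (fun i : 'I_m.+1 => net_idx N (p ^+ i)).
  by rewrite !card_ord.
have valX n : val (p ^+ n) = val p ^+ n by rewrite rmorphXn.
have sep n d : (n <= m)%N -> (0 < d)%N ->
    e <= absv (val (p ^+ n) - val (p ^+ (n + d)%N)).
  move=> nm d0; rewrite !valX exprD -{1}[_ ^+ n]mulr1 -mulrBr absvM absvXn.
  apply: le_trans em _.
  have -> : absv (val p) ^+ m = absv (val p) ^+ n * absv (val p) ^+ (m - n).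
    by rewrite -exprD subnKC.
  rewrite ler_pM2l ?exprn_gt0//.
  apply: (@le_trans _ _ 1); first by rewrite exprn_ile1 ?absv_ge0// ltW.
  rewrite leNgt; apply/negP => lt1.
  suff : absv (1 : k) < 1 by rewrite absv1 ltxx.
  rewrite -[1 in X in X < _](subrK (val p ^+ d)).
  by apply: absvD_lt => //; rewrite absvXn exprn_ilt1 ?absv_ge0// -lt0n.
move=> i j /eqP; rewrite net_idxE => lt; apply: val_inj => /=.
have [ij|ij|//] := ltngtP i j.
  have := sep i (j - i)%N; rewrite -ltnS subn_gt0 => /(_ (ltn_ord i) ij).
  by rewrite subnKC ?(ltnW ij)// leNgt lt.
have := sep j (i - j)%N; rewrite -ltnS subn_gt0 => /(_ (ltn_ord j) ij).
by rewrite subnKC ?(ltnW ij)// absvB leNgt lt.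
Qed.

(** The multiples of x cannot all lie in distinct classes of a finite net. *)
Lemma torsion_mod_ball e x : 0 < e ->
  exists2 n, (0 < n)%N & absv (val (x *+ n)) < e.
Proof.
move=> e0; have [N _] := net_exists e0.
pose f (i : 'I_(net_size N).+1) := net_idx N (x *+ i).
have /injectivePn[i [j ij fij]] : ~~ injectiveb f.
  apply/negP => /injectiveP/leq_card; by rewrite !card_ord ltnn.
wlog lt_ij : i j ij fij / (i < j)%N => [hw|].
  have [ij'|ij'|/val_inj eq] := ltngtP i j.
  - exact: (hw i j).
  - by apply: (hw j i) => //; rewrite eq_sym.
  - by rewrite eq eqxx in ij.
exists (j - i)%N; first by rewrite subn_gt0.
by rewrite mulrnBr 1?ltnW// valO_B; apply/(net_near N).
Qed.

Lemma nbhs_integersP x (U : set O) : nbhs x U ->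
  exists2 e, 0 < e & forall y, absv (val x - val y) < e -> U y.
Proof.
rewrite nbhsE => -[V [[W Wop WV] Vx] VU].
have : nbhs (val x) W.
  by apply: open_nbhs_nbhs; split => //; rewrite -WV in Vx.
rewrite nbhs_absvE => -[e /= e0 eW]; exists e => // y xy.
by apply: VU; rewrite -WV; apply: eW.
Qed.

End Integers.
Arguments net_pt {R k e} n.
Arguments net_idx {R k e} n.
Arguments net_ptK {R k e} n.

(** * The dual of the ring of integers *)

(** As z^2 - 1 = (z - 1) (z + 1) and |z + 1| >= 3/2 when |z - 1| <= 1/2, each
    squaring multiplies the distance to 1 by at least 3/2. *)
Lemma no_small_subgroup (R : realType) (z : R[i]) :
  (forall n, `|z ^+ n - 1| <= 2^-1) -> z = 1.
Proof.
move=> small; pose d := complex.Re `|z - 1|.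
have dE : `|z - 1| = d%:C by rewrite /d normc_def.
have two0 : 2 != 0 :> R[i] by rewrite pnatr_eq0.
have growth n : `|z - 1| * (1 + n%:R / 2) <= `|z ^+ (2 ^ n) - 1|.
  elim: n => [|n IH]; first by rewrite mul0r addr0 mulr1 expn0 expr1.
  pose u := z ^+ (2 ^ n).
  have -> : z ^+ (2 ^ n.+1) - 1 = (u - 1) * (u + 1).
    by rewrite expnS mulnC exprM -/u -subr_sqr expr1n.
  have u1 : 1 + 2^-1 <= `|u + 1|.
    have -> : 1 + 2^-1 = 2 - 2^-1 :> R[i] by field.
    have -> : u + 1 = 2 - (1 - u) by ring.
    apply: le_trans (lerB_dist _ _); rewrite normr_nat lerD2l lerN2 distrC.
    exact: small.
  rewrite normrM; apply: le_trans (ler_pM _ _ IH u1).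
  - rewrite -mulrA ler_wpM2l// -natr1 -subr_ge0.
    have -> : (1 + n%:R / 2) * (1 + 2^-1) - (1 + (n%:R + 1) / 2) =
        n%:R / 4 :> R[i] by field.
    by rewrite divr_ge0 ?ler0n.
  - by rewrite mulr_ge0 ?addr_ge0 ?divr_ge0 ?ler0n.
  - by rewrite addr_ge0 ?invr_ge0 ?ler0n.
have bound n : d * (1 + n%:R / 2) <= 2^-1.
  rewrite -lecR rmorphM rmorphD rmorphM !fmorphV !rmorph_nat rmorph1 /= -dE.
  exact: le_trans (growth n) (small _).
apply/eqP; rewrite -subr_eq0 -normr_eq0 dE fmorph_eq0.
have d0 : 0 <= d by rewrite -lecR -dE; exact: normr_ge0.
have [_ //|d_neq0] := eqVneq d 0.
have dpos : 0 < d by rewrite lt_neqAle eq_sym d_neq0.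
have dn := archi_boundP (ltW (divr_gt0 ltr01 dpos)).
have := bound (Num.bound (1 / d)); move: dn; rewrite ltr_pdivrMr// => dn.
nra.
Qed.

Section Characters.
Variables (R : realType) (k : nonArchLocalFieldType R).
Notation O := (ring_of_integers k).
Notation dual := (pontryagin_dual R O).
Implicit Types (x y : O) (e : R) (chi psi : dual).

Lemma dual0 chi : chi 0 = 1.
Proof.
apply: (mulfI (dual_neq0 chi 0)).
by rewrite -(characterD (dualP chi)) addr0 mulr1.
Qed.

Lemma dualMn chi x n : chi (x *+ n) = chi x ^+ n.
Proof.
elim: n => [|n IH]; first by rewrite mulr0n dual0.
by rewrite mulrS exprS (characterD (dualP chi)) IH.
Qed.

Lemma dual_trivial_near0 chi :
  exists2 e, 0 < e & forall x, absv (val x) < e -> chi x = 1.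
Proof.
have half0 : 0 < 2^-1 :> R[i] by rewrite invr_gt0 ltr0n.
have /cvgrPdist_le /(_ _ half0) := character_continuous (dualP chi) (x := 0).
move=> /nbhs_integersP[e e0 he]; exists e => // x xe.
apply: no_small_subgroup => n; rewrite -dualMn distrC.
have := he (x *+ n); rewrite dual0; apply; rewrite rmorph0 sub0r absvN.
have -> : val (x *+ n) = val x *+ n by rewrite raddfMn.
elim: n => [|n IH]; first by rewrite mulr0n absv0.
by rewrite mulrS absvD_lt.
Qed.

(** It is enough to know |f x| = 1 near 0, because any x has a multiple in
    the ball of radius e; triviality on a ball gives uniform continuity. *)
Lemma ball_character (f : O -> R[i]) e : 0 < e ->
    {morph f : x y / x + y >-> x * y} ->
    (forall x, absv (val x) < e -> `|f x| = 1) ->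
    (exists2 d, 0 < d & forall x, absv (val x) < d -> f x = 1) ->
  is_character f.
Proof.
move=> e0 fD f_norm [d d0 fd]; split=> //; last first.
  move=> x; have [n n0 /f_norm xn] := torsion_mod_ball x e0.
  have fMn : f (x *+ n) = f x ^+ n.
    elim: n {n0 xn} => [|n IH]; last by rewrite mulrS exprS fD IH.
    by rewrite mulr0n expr0 fd// rmorph0 absv0.
  apply/eqP; rewrite -(@pexpr_eq1 _ _ n)//; last first.
  by rewrite -normrX -fMn xn.
move=> x; apply/(@cvgrPdist_lt _ R[i]^o _ (nbhs (x : O))) => /= eps eps0.
have : nbhs x [set y : O | absv (val x - val y) < d].
  exact: nbhs_integers_absv.
apply: filterS => y /= xy.
by rewrite -{1}(subrK y x) fD fd// mul1r subrr normr0.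
Qed.

Definition ball0 e : set O := [set x | absv (val x) < e].

Lemma ball_hom_on e : 0 < e -> hom_on (ball0 e) (fun=> 1 : R[i]).
Proof.
move=> e0; split=> [|x y xe ye|//|x y _ _]; last by rewrite mulr1.
  by rewrite /ball0/= absv0.
by rewrite /ball0/= absvD_lt// absvN.
Qed.

Lemma ball_cover e : 0 < e ->
  exists s : seq O, forall y, exists2 x, x \in s & ball0 e (y - x).
Proof. exact: totally_bounded_integers. Qed.

(** The trivial character of the open unit ball, which does not contain 1,
    extends with a root of unity w <> 1 as its value at 1. *)
Lemma dual_nontrivial : exists chi x, chi x != 1.
Proof.
have e0 := @ltr01 R.
have hB := ball_hom_on e0.
have [m m0 mE] := order_mod hB (torsion_mod_ball 1 e0).
have m1 : (1 < m)%N.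
  rewrite ltn_neqAle eq_sym m0 andbT; apply/eqP => m_eq1.
  by have := (mE 1%N).2; rewrite m_eq1 dvdnn /ball0/= absv1 ltxx => /(_ isT).
have [|w wm w1] := @unity_root_neq1 R[i] m m1.
  by rewrite pnatr_eq0 -lt0n.
have [H [f1 [h1 BH H1 f1B f1x]]] := extend_one hB m0 mE wm.
have [s hs] := ball_cover e0.
have [x|y|f fD fH] := extend_hom (s := s) h1.
- by have [n n0 xn] := torsion_mod_ball x e0; exists n => //; exact: BH.
- by have [x xs yx] := hs y; exists x => //; exact: BH.
have fB x : absv (val x) < 1 -> f x = 1.
  by move=> x1; rewrite fH ?f1B//; exact: BH.
have fC : is_character f.
  apply: (ball_character e0 fD) => [x /fB ->|]; first by rewrite normr1.
  by exists 1.
by exists (Dual fC), 1; rewrite /dual_eval/= fH ?f1x.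
Qed.

(** The values at c x are prescribed by psi x; this is a character of c O,
    which contains the ball of radius |c|, and it extends to O. *)
Lemma dual_scale_surj (c : O) psi : c != 0 ->
  exists chi, forall x, chi (c * x) = psi x.
Proof.
move=> c_neq0.
have c0 : 0 < absv (val c).
  by rewrite absv_gt0; apply: contra_neq c_neq0 => c0; exact: val_inj.
have cI : injective (fun x : O => c * x).
  move=> x y /(congr1 val)/= E; apply: val_inj.
  by apply: (mulfI _ E); rewrite -absv_gt0.
pose H : set O := range (fun x => c * x).
pose f0 y := psi (xget 0 [set x | c * x = y]).
have f0E x : f0 (c * x) = psi x.
  by rewrite /f0; case: xgetP => [z _ /cI -> //|/(_ x) []].
have hH : hom_on H f0.
  split.
  - by exists 0 => //; rewrite mulr0.
  - by move=> _ _ [x _ <-] [y _ <-]; exists (x - y) => //; rewrite mulrBr.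
  - by rewrite -(mulr0 c) f0E dual0.
  - move=> _ _ [x _ <-] [y _ <-].
    by rewrite -mulrDr !f0E (characterD (dualP psi)).
have BH y : absv (val y) < absv (val c) -> H y.
  move=> yc.
  have yO : integral (val y / val c).
    by rewrite /integral absvM absvV ler_pdivrMr// mul1r ltW.
  exists (Sub (val y / val c) yO : O) => //; apply: val_inj => /=.
  by rewrite mulrC divfK// -absv_gt0.
have [s hs] := ball_cover c0.
have [x|y|f fD fH] := extend_hom (s := s) hH.
- by have [n n0 xn] := torsion_mod_ball x c0; exists n => //; exact: BH.
- by have [x xs yx] := hs y; exists x => //; exact: BH.
have fE x : f (c * x) = psi x by rewrite fH ?f0E//; exists x.
have fC : is_character f.
  apply: (ball_character c0 fD) => [y /BH[x _ <-]|].
    by rewrite fE (character_norm (dualP psi)).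
  have [e e0 he] := dual_trivial_near0 psi.
  exists (Num.min (absv (val c)) (e * absv (val c))).
    by rewrite lt_min c0 mulr_gt0.
  move=> y; rewrite lt_min => /andP[/BH[x _ <-]].
  rewrite rmorphM absvM mulrC ltr_pM2r// fE; exact: he.
by exists (Dual fC).
Qed.

End Characters.

(** * Simultaneous diagonalization of unitary matrices *)

(** Reduces simultaneous diagonalization of an infinite family to that of a
    finite list. *)
Lemma span_of_family (F : fieldType) (V : vectType F) (I : choiceType)
    (v : I -> V) :
  exists s : seq I, forall i, v i \in <<map v s>>%VS.
Proof.
pose dims d := `[< exists s : seq I, \dim <<map v s>>%VS = d >].
have exd : exists d, dims d.
  by exists (\dim <<map v [::]>>%VS); apply/asboolP; exists [::].
have bound d : dims d -> (d <= \dim {:V})%N.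
  by move=> /asboolP[s <-]; apply/dimvS/subvf.
have [_ /asboolP[s <-] smax] := ex_maxnP exd bound.
exists s => i.
have sub : (<<map v s>> <= <<map v (i :: s)>>)%VS.
  by apply: sub_span => x xs; rewrite inE xs orbT.
suff /eqP -> : <<map v s>>%VS == <<map v (i :: s)>>%VS.
  by apply: memv_span; rewrite map_f// mem_head.
by rewrite eqEdim sub; apply: smax; apply/asboolP; exists (i :: s).
Qed.

Lemma unitary_diagonalizable (C : numClosedFieldType) n (M : 'M[C]_n) :
  M \is unitarymx -> diagonalizable M.
Proof.
move=> Mu.
have Mn : M \is normalmx.
  apply/normalmxP; have MM := unitarymxP Mu.
  by rewrite MM (mulmx1C MM).
exists (spectralmx M); first exact: spectral_unit.
apply/similar_diagPex; exists (spectral_diag M).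
apply/similarLR; first exact: spectral_unit.
by rewrite conjVmx ?spectral_unit//; exact/orthomx_spectralP.
Qed.

Lemma unitary_codiagonalizable (C : numClosedFieldType) n (I : choiceType)
    (M : I -> 'M[C]_n) :
    (forall i, M i \is unitarymx) -> (forall i j, comm_mx (M i) (M j)) ->
  exists2 P, P \in unitmx & forall i, is_diag_mx (P *m M i *m invmx P).
Proof.
move=> Mu Mc; have [s sM] := span_of_family M.
have [P Pu /allP PD] : codiagonalizable (map M s).
  apply/codiagonalizableP; split=> [_ _ /mapP[i _ ->] /mapP[j _ ->]//|].
  by move=> _ /mapP[i _ ->]; exact: unitary_diagonalizable.
exists P => // i; have := sM i; rewrite -[map M s]/(tval (in_tuple (map M s))).
move=> /coord_span ->; apply/is_diag_mxP => a b ab.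
rewrite mulmx_sumr mulmx_suml summxE big1// => j _.
rewrite -scalemxAr -scalemxAl mxE.
have /PD : (map M s)`_j \in map M s by rewrite mem_nth.
rewrite /= /similar_to conjumx// => /is_diag_mxP ->//.
by rewrite mulr0.
Qed.

Lemma infinite_pigeonhole (T : choiceType) (A : set T) n (f : T -> 'I_n) :
  infinite_set A -> exists a b, [/\ A a, A b, a != b & f a = f b].
Proof.
move=> /(infinite_set_fset n.+1)[B BA Bn].
have /injectivePn[a [b ab fab]] : ~~ injectiveb (fun x : B => f (val x)).
  apply/negP => /injectiveP/leq_card; rewrite card_ord -cardfE leqNgt.
  by move=> /negP; apply.
by exists (val a), (val b); split=> //; apply: BA; exact: valP.
Qed.

(** * Finite-dimensional representations of the semidirect product *)

Lemma unit_val_inj (S : comNzRingType) : injective (@unit_val S).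
Proof.
move=> u v uv; have hu : (val u).1 * (val u).2 = 1 := eqP (valP u).
have hv : (val u).1 * (val v).2 = 1.
  by rewrite [(val u).1]uv; exact: (eqP (valP v)).
have eq_inv : (val u).2 = (val v).2.
  transitivity ((val u).1 * (val v).2 * (val u).2); first by rewrite hv mul1r.
  by rewrite mulrAC hu mul1r.
apply: val_inj; rewrite (surjective_pairing (val u)) (surjective_pairing (val v)).
by congr pair; [exact: uv|exact: eq_inv].
Qed.

Section FiniteDimensionalRepresentations.
Variables (R : realType) (k : nonArchLocalFieldType R).
Notation O := (ring_of_integers k).
Notation dual := (pontryagin_dual R O).
Variable A : groupClosed (unit_group O).
Notation G := (semidirect (restrict_action A (dual_action k))).
Notation to := (restrict_action A (dual_action k)).

Definition inA (a : subgroup A) : G := (a, 1%g).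
Definition inN (chi : dual) : G := (1%g, chi).

Lemma dual_mulC (chi psi : dual) : (chi * psi = psi * chi)%g.
Proof. by apply: val_inj; apply/funext => x; exact: mulrC. Qed.

Lemma inN_mul chi psi : (inN chi * inN psi)%g = inN (chi * psi)%g.
Proof.
rewrite /inN; congr (_, _); first exact: mulg1.
by congr (_ * _)%g; exact: (act1 to).
Qed.

Lemma inA_conj a chi : (inA a * inN chi = inN (to a chi) * inA a)%g.
Proof.
congr (_, _) => /=; first by rewrite mulg1 mul1g.
rewrite mul1g -[LHS]mulg1; congr (_ * _)%g; exact/esym/(act1 to).
Qed.

(** The ratio of a chi to b chi is x |-> chi ((a^-1 - b^-1) x), and
    a^-1 - b^-1 is nonzero, so [dual_scale_surj] provides chi. *)
Lemma act_ratio (a b : subgroup A) : a != b ->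
  forall psi : dual, exists chi : dual, to a chi = (psi * to b chi)%g.
Proof.
move=> ab psi.
pose u := unit_val (val a)^-1%g; pose v := unit_val (val b)^-1%g.
have c0 : u - v != 0.
  apply: contra ab; rewrite subr_eq0 => /eqP/unit_val_inj/invg_inj/val_inj ->.
  exact: eqxx.
have [chi chiE] := dual_scale_surj psi c0.
exists chi; apply: val_inj; apply/funext => x.
rewrite [LHS]/(chi (u * x)) [RHS]/(psi x * chi (v * x)).
have := characterD (dualP chi) ((u - v) * x) (v * x).
by rewrite -mulrDl subrK chiE.
Qed.

(** The diagonal entries l i of the dual in a common eigenbasis are permuted
    by A.  The pigeonhole principle gives distinct a and b with
    l i o a = l i o b, and [act_ratio] then gives l i = 1. *)
Lemma finite_dim_rep_trivial n (phi : {multiplicative G -> unitary_group R n}) :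
  infinite_set [set` A] -> forall chi, phi (inN chi) = 1%g.
Proof.
move=> Ainf.
pose M g : 'M_n := val (phi g).
have MM g h : M (g * h)%g = M g *m M h by rewrite /M gmulfM.
have [|chi psi|P Pu PD] :=
  @unitary_codiagonalizable _ n dual (fun chi => M (inN chi)).
- by move=> chi; exact: (valP (phi (inN chi))).
- by rewrite /comm_mx -!MM !inN_mul dual_mulC.
pose Q g := P *m M g *m invmx P.
have QM g h : Q (g * h)%g = Q g *m Q h.
  by rewrite /Q MM !mulmxA mulmxKV.
have Q_off chi i j : i != j -> Q (inN chi) i j = 0.
  exact: (is_diag_mxP (PD chi)).
have Qu g : Q g \in unitmx.
  rewrite !unitmx_mul Pu unitmx_inv Pu.
  by rewrite (unitarymx_unit (valP (phi g))).
have Q1 g : Q g = 1%:M -> M g = 1%:M.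
  move=> /(congr1 (fun X => invmx P *m X *m P)).
  by rewrite /Q !mulmxA mulVmx// mul1mx mulmxKV// mulmx1 mulVmx.
(* The change of basis only enters through these properties of Q. *)
clearbody Q => {PD Pu P}.
pose l i chi := Q (inN chi) i i.
have QD chi : Q (inN chi) = diag_mx (\row_i l i chi).
  apply/matrixP => i j; rewrite !mxE.
  have [->|ij] := eqVneq i j; first by rewrite mulr1n.
  by rewrite mulr0n Q_off.
have lM i chi psi : l i (chi * psi)%g = l i chi * l i psi.
  rewrite {1}/l -inN_mul QM mxE (bigD1 i)//= big1 ?addr0// => j ji.
  by rewrite (Q_off psi j i ji) mulr0.
have l_neq0 i chi : l i chi != 0.
  have := Qu (inN chi); rewrite QD unitmxE det_diag unitfE.
  by move=> /prodf_neq0/(_ i isT); rewrite !mxE.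
(* Row i of Q (inA a) has a nonzero entry, in some column j; comparing the
   (i, j) entries of Q a *m Q chi = Q (a chi) *m Q a identifies l i o a. *)
have l_orbit i a : exists j, forall chi, l i (to a chi) = l j chi.
  have [j Qij] : exists j, Q (inA a) i j != 0.
    apply/existsP; rewrite -negb_forall; apply/negP => /forallP row0.
    have : row i (Q (inA a)) *m invmx (Q (inA a)) = 0.
      rewrite (_ : row i _ = 0) ?mul0mx//; apply/rowP => j; rewrite !mxE.
      exact/eqP/row0.
    rewrite -row_mul mulmxV// => /rowP/(_ i); rewrite !mxE eqxx => /eqP.
    by rewrite oner_eq0.
  exists j => chi; apply: (mulfI Qij).
  have := congr1 Q (inA_conj a chi); rewrite !QM !QD.
  move=> /matrixP/(_ i j); rewrite mul_mx_diag mul_diag_mx !mxE => ->.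
  exact: mulrC.
have l1 i chi : l i chi = 1.
  pose tr a := sval (cid (l_orbit i a)).
  have trP a : forall chi, l i (to a chi) = l (tr a) chi.
    exact: svalP (cid (l_orbit i a)).
  pose f (u : unit_group O) : 'I_n := if insub u is Some a then tr a else i.
  have [u [v [/= uA vA uv fuv]]] := infinite_pigeonhole f Ainf.
  pose a : subgroup A := Sub u uA; pose b : subgroup A := Sub v vA.
  have ab : tr a = tr b by move: fuv; rewrite /f !insubT.
  have [psi psiE] := act_ratio (a := a) (b := b) uv chi.
  apply: (mulIf (l_neq0 i (to b psi))).
  by rewrite mul1r -lM -psiE !trP ab.
move=> chi; apply: val_inj; rewrite /= -/(M (inN chi)).
apply: Q1; rewrite QD -diag_const_mx; congr diag_mx.
by apply/rowP => i; rewrite !mxE l1.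
Qed.

End FiniteDimensionalRepresentations.

(** * Unitary matrices and the Hilbert-Schmidt distance *)

Lemma diag_mx_unitary (C : numClosedFieldType) n (d : 'rV[C]_n) :
  (forall i, `|d 0 i| = 1) -> diag_mx d \is unitarymx.
Proof.
move=> d1; apply/unitarymxP; rewrite tr_diag_mx map_diag_mx mulmx_diag.
rewrite -diag_const_mx; congr diag_mx; apply/rowP => i; rewrite !mxE.
by rewrite -normCK d1 expr1n.
Qed.

Lemma perm_mx_unitary (C : numClosedFieldType) n (s : 'S_n) :
  (perm_mx s : 'M[C]_n) \is unitarymx.
Proof.
apply/unitarymxP; rewrite tr_perm_mx map_perm_mx.
by rewrite -perm_mxM mulgV perm_mx1.
Qed.

Lemma hs_distxx (R : realType) n (u : unitary_group R n) : hs_dist u u = 0.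
Proof. by rewrite /hs_dist subrr mulmx0 mxtrace0 /= mulr0 sqrtr0. Qed.

(** For unitary U, (U - 1)^* (U - 1) = 2 - U - U^*. *)
Lemma hs_dist1_traceless (R : realType) n (u : unitary_group R n) :
  (0 < n)%N -> \tr (val u) = 0 -> hs_dist u 1%g = Num.sqrt 2.
Proof.
move=> n0 tru; rewrite /hs_dist; congr Num.sqrt.
set U := val u.
have UU : U^t* *m U = 1%:M by exact: mulmx1C (unitarymxP (valP u)).
have -> : (U - 1%:M)^t* *m (U - 1%:M) = 1%:M + 1%:M - U - U^t*.
  rewrite [(U - _)^T]linearB/= map_mxB trmx1 map_mx1.
  rewrite mulmxBl !mulmxBr UU !mulmx1 mul1mx.
  by rewrite opprB addrACA -[RHS]addrA [- U^t* - U]addrC.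
have trU' : \tr (U^t*) = 0 by rewrite trace_map_mx mxtrace_tr tru rmorph0.
rewrite !raddfB raddfD /= mxtrace1 tru trU' !subr0 -natrD.
rewrite -(rmorph_nat (real_complex R)) /= natrD -mulr2n -[_ *+ 2]mulr_natr.
rewrite mulrA mulVf ?mul1r//.
by rewrite pnatr_eq0 -lt0n.
Qed.

(** * Models on finite quotients *)

Section FiniteQuotients.
Variables (R : realType) (k : nonArchLocalFieldType R).
Notation O := (ring_of_integers k).
Notation dual := (pontryagin_dual R O).
Variable A : groupClosed (unit_group O).
Notation to := (restrict_action A (dual_action k)).
Notation G := (semidirect to).

Section Net.
Variables (e : R) (N : net k e).
Notation n := (net_size N).
Notation pt := (net_pt N).
Notation idx := (net_idx N).

Definition trivial_on_ball (chi : dual) :=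
  forall x, absv (val x) < e -> chi x = 1.

Lemma chi_pt (chi : dual) x : trivial_on_ball chi -> chi (pt (idx x)) = chi x.
Proof.
move=> chi1; rewrite -[x in RHS](subrK (pt (idx x))) (characterD (dualP chi)).
by rewrite [chi (x - _)]chi1 ?mul1r//; exact: net_pt_near.
Qed.

(** Multiplication by c is 1-Lipschitz, so it is defined on classes. *)
Lemma idx_mul (c x : O) : idx (c * pt (idx x)) = idx (c * x).
Proof.
apply/net_near; rewrite -mulrBr absvM absvB.
apply: le_lt_trans (net_pt_near N x).
by rewrite ler_piMl ?absv_ge0//; exact: (valP c).
Qed.

(** Multiplication by u^-1, not by u, because [perm_mx s] moves the unit
    vectors by the inverse of s. *)
Definition shift (u : unit_group O) (i : 'I_n) : 'I_n :=
  idx (unit_val u^-1%g * pt i).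

Lemma shiftM u v i : shift v (shift u i) = shift (u * v)%g i.
Proof. by rewrite /shift idx_mul mulrA -unit_valM -invgM. Qed.

Lemma shift1 i : shift 1%g i = i.
Proof. by rewrite /shift invg1 unit_val1 mul1r net_ptK. Qed.

Lemma shift_inj u : injective (shift u).
Proof.
by apply: (can_inj (g := shift u^-1%g)) => i; rewrite shiftM mulgV shift1.
Qed.

Definition shift_perm u : 'S_n := perm (@shift_inj u).

Lemma shift_permM u v : shift_perm (u * v)%g = (shift_perm u * shift_perm v)%g.
Proof. by apply/permP => i; rewrite permM !permE shiftM. Qed.

Definition net_row (chi : dual) : 'rV[R[i]]_n := \row_i chi (pt i).

Definition net_mx (g : G) : 'M[R[i]]_n :=
  diag_mx (net_row g.2) *m perm_mx (shift_perm (val g.1)).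

Lemma net_mx_unitary g : net_mx g \is unitarymx.
Proof.
apply: mul_unitarymx; last exact: perm_mx_unitary.
by apply: diag_mx_unitary => i; rewrite mxE (character_norm (dualP g.2)).
Qed.

Definition net_rep (g : G) : unitary_group R n :=
  exist _ (net_mx g) (net_mx_unitary g).

(** The permutation matrix P of a satisfies P diag(psi) = diag(a psi) P, up to
    the replacement of a^-1 x by the representative of its class; the values
    of psi do not see this replacement when psi is trivial on the ball. *)
Lemma net_repM g h : trivial_on_ball h.2 ->
  (net_rep g * net_rep h)%g = net_rep (g * h)%g.
Proof.
move=> h1; apply: val_inj; rewrite /= /net_mx.
have -> : diag_mx (net_row (g * h)%g.2) =
    diag_mx (net_row g.2) *m diag_mx (net_row (to g.1 h.2)).
  by rewrite mulmx_diag; congr diag_mx; apply/rowP => i; rewrite !mxE.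
rewrite [(g * h)%g.1]/(g.1 * h.1)%g valM shift_permM perm_mxM !mulmxA.
congr (_ *m _); rewrite -!mulmxA; congr (_ *m _).
apply/matrixP => i j; rewrite mul_mx_diag mul_diag_mx !mxE.
have [<-|_] := eqVneq; last by rewrite mul0r mulr0.
by rewrite mul1r mulr1 permE /shift chi_pt.
Qed.

(** Translation by x permutes the classes and multiplies the sum of the values
    of chi by chi x <> 1. *)
Lemma net_rep_traceless chi x : trivial_on_ball chi -> chi x != 1 ->
  \tr (val (net_rep (inN A chi))) = 0.
Proof.
move=> chi1 chix; rewrite /= /net_mx /=.
have -> : shift_perm 1%g = 1%g.
  by apply/permP => i; rewrite permE perm1 shift1.
rewrite perm_mx1 mulmx1 mxtrace_diag.
set S := \sum_i _; suff : S = chi x * S.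
  move=> /eqP; rewrite -subr_eq0 -{1}[S]mul1r -mulrBl mulf_eq0 subr_eq0.
  by rewrite eq_sym (negbTE chix) => /eqP.
pose s i := idx (x + pt i).
have s_inj : injective s.
  move=> i j /net_near h; rewrite -(net_ptK N i) -(net_ptK N j); apply/net_near.
  by move: h; rewrite opprD addrACA subrr add0r.
rewrite {1}/S (reindex_inj s_inj) mulr_sumr; apply: eq_bigr => i _.
by rewrite !mxE /s chi_pt// (characterD (dualP chi)).
Qed.

End Net.

Definition quotient_model e n (F : G -> unitary_group R n) : Prop :=
  (forall g h, trivial_on_ball e h.2 -> (F g * F h)%g = F (g * h)%g) /\
  (forall chi x, trivial_on_ball e chi -> chi x != 1 ->
     \tr (val (F (inN A chi))) = 0).

Lemma net_rep_model e (N : net k e) : quotient_model e (@net_rep e N).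
Proof. by split; [exact: net_repM|exact: net_rep_traceless]. Qed.

End FiniteQuotients.

Lemma net_size_gt0 (R : realType) (k : nonArchLocalFieldType R) e (N : net k e) :
  (0 < net_size N)%N.
Proof. exact: leq_ltn_trans (leq0n _) (ltn_ord (net_idx N 0)). Qed.

(** * Failure of stability *)

Theorem corollary6 (R : realType) (k : nonArchLocalFieldType R)
    (A : groupClosed (unit_group (ring_of_integers k))) :
  countable [set` A]%classic -> infinite_set [set` A]%classic ->
  ~ hs_stable R (semidirect (restrict_action A (dual_action k))).
Proof.
move=> _ Ainf stable.
have [p /andP[p0 p1]] : exists p : ring_of_integers k, 0 < absv (val p) < 1.
  have [x /[dup] x01 /andP[x0 x1]] := @absv_lt1 R k.
  by exists (Sub x (ltW x1)).
pose q := absv (val p).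
have rad_gt0 m : 0 < q ^+ m by apply: exprn_gt0.
pose N m : net k (q ^+ m) := sval (cid (@net_exists R k _ (rad_gt0 m))).
have sizeN m : (m < net_size (N m))%N.
  by apply: (@net_size_gt _ _ _ (N m) p); rewrite ?p0.
have eventually_trivial (chi : pontryagin_dual R (ring_of_integers k)) :
    exists M, forall m, (M <= m)%N -> trivial_on_ball (q ^+ m) chi.
  have [e e0 he] := dual_trivial_near0 chi.
  have [|M hM] := @expr_eventually_lt R q e _ e0; first by rewrite p1 ltW.
  by exists M => m /hM qm x xm; apply: he; apply: lt_trans xm qm.
pose model_or_trivial n
    (F : semidirect (restrict_action A (dual_action k)) -> unitary_group R n) :=
  (exists2 m, net_size (N m) = n & quotient_model (q ^+ m) F) \/
  ((forall m, net_size (N m) <> n) /\ forall g, F g = 1%g).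
have exF n : exists F, @model_or_trivial n F.
  have [[m <-]|noN] := pselect (exists m, net_size (N m) = n).
    by exists (@net_rep _ _ A _ (N m)); left; exists m => //; exact: net_rep_model.
  by exists (fun=> 1%g); right; split=> // m mn; apply: noN; exists m.
pose f n := sval (cid (exF n)).
have fP n : model_or_trivial n (f n) := svalP (cid (exF n)).
(* Each m < M is the index of a single dimension, so beyond big M only
   radii q ^+ m with m >= M occur. *)
pose big M := \max_(m < M) net_size (N m).
have index_ge M n m : (big M < n)%N -> net_size (N m) = n -> (M <= m)%N.
  move=> Mn mn; rewrite leqNgt; apply/negP => mM.
  have := leq_bigmax (F := fun m : 'I_M => net_size (N m)) (Ordinal mM).
  by rewrite /= mn leqNgt Mn.
have f_asym : asymptotic_hom f.
  move=> g h; have [M hM] := eventually_trivial h.2.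
  apply: (@cvg_near_cst _ _ 0); exists (big M).+1 => // n /= Mn.
  apply/eqP; have [[m mn [fM _]]|[_ f1]] := fP n.
    by rewrite fM ?hs_distxx//; apply: hM; exact: index_ge Mn mn.
  by rewrite !f1 mulg1 hs_distxx.
have [phi phiP] := stable f f_asym.
have [chi [x chix]] := @dual_nontrivial R k.
have [M hM] := eventually_trivial chi.
have /cvgrPdist_lt /(_ 1 ltr01) [n0 _ near0] := phiP (inN A chi).
pose m := maxn n0 (big M); pose n := net_size (N m).
have mn : (m < n)%N := sizeN m.
have Mn : (big M < n)%N by apply: leq_ltn_trans mn; exact: leq_maxr.
have n0n : (n0 <= n)%N by apply/ltnW/(leq_ltn_trans _ mn)/leq_maxl.
have := near0 n n0n; rewrite /= finite_dim_rep_trivial//.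
have [[m' m'n [_ ftr]]|[/(_ m)//]] := fP n.
rewrite hs_dist1_traceless; last 2 first.
- exact: net_size_gt0.
- by apply: (ftr _ x) chix; apply: hM; exact: index_ge Mn m'n.
rewrite sub0r normrN ger0_norm ?sqrtr_ge0// => lt1.
suff : (1 : R) <= Num.sqrt 2 by rewrite leNgt lt1.
by rewrite -[leLHS]sqrtr1 ler_wsqrtr// ler1n.
Qed.
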